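(* The discrete Clebsch variational principle $$\delta\sum_{n=1}^N\left(l(\mathrm{X}^{n-1})+\left\langle \mathrm{P}^{n-1},\frac1{\Delta t}\mathrm{Q}^{n-1}\,\overline{\log}\big((\mathrm{Q}^{n-1})^{-1}\mathrm{Q}^n\big)-\mathrm{Q}^{n-1}\mathrm{X}^{n-1}\right\rangle\right)=0$$ leads to the following first-order symplectic Euler discretisation: $$\frac{\delta l}{\delta\mathrm{X}}(\mathrm{X}^{n-1})=(\mathrm{Q}^{n-1})^\dagger\mathrm{P}^{n-1},$$ $$\mathrm{Q}^n=\mathrm{Q}^{n-1}\,\overline{\exp}(\Delta t\,\mathrm{X}^{n-1}),$$ $$\mathrm{P}^n=\big((\mathrm{Q}^n)^\dagger\big)^{-1}\Big(\big(T_{\overline{\exp}(\Delta t\mathrm{X}^n)}\overline{\log}\big)^\dagger\Big)^{-1}\big(\overline{\exp}(\Delta t\mathrm{X}^{n-1})\big)^\dagger\,\big(T_{\overline{\exp}(\Delta t\mathrm{X}^{n-1})}\overline{\log}\big)^\dagger(\mathrm{Q}^{n-1})^\dagger\mathrm{P}^{n-1}\big(\overline{\exp}(\Delta t\mathrm{X}^n)\big)^{-1},$$ where $\overline{\exp}$ is the inverse of the $\overline{\log}$ operation.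
   Context: Setting: matrix groups. The group elements $\mathrm{Q}^n$ are $d$-dimensional (i.e. $d\times d$) complex matrices; $V$ is the vector space of matrices $\mathrm{X}$ acting through the velocity map $\mathcal{L}_{\mathrm{X}}\mathrm{Q}=\mathrm{Q}\mathrm{X}$ (right matrix multiplication), for example $V=\mathfrak{so}(3)$ acting on $SO(3)$. The $\mathrm{P}^n$ are Lagrange multipliers, $l$ is a given functional on $V$, and $\Delta t$ is the time step. $\dagger$ denotes the transpose-conjugate. The inner product is $\langle\mathrm{P},\dot{\mathrm{Q}}\rangle=\mathrm{Tr}(\mathrm{P}\dot{\mathrm{Q}}^\dagger)=\sum_{kl}P_{kl}\overline{\dot Q_{kl}}$; in the variational principle it is taken at the point $\mathrm{Q}^{n-1}$. The variational derivative is defined by $\delta l=\langle\frac{\delta l}{\delta\mathrm{X}},\delta\mathrm{X}\rangle$. The exponential map is the solution of $\frac{d}{dt}\exp(t\mathrm{X})=\exp(t\mathrm{X})\mathrm{X}$, $\exp(0)=\mathrm{Id}$, and the logarithm is defined by $\log(\exp(\mathrm{X}))=\mathrm{X}$ for $\mathrm{X}\in V$. $\overline{\log}:\Omega\to V$, with $\Omega$ its domain of group elements, is an approximate logarithm: $\overline{\log}(A)=\log(A)+\mathcal{O}((A-I)^p)$ for some positive integer $p$, where $I$ is the identity. Then $\frac1{\Delta t}\mathrm{Q}_1\overline{\log}(\mathrm{Q}_1^{-1}\mathrm{Q}_2)$ approximates the time derivative at $\mathrm{Q}_1$ of a solution passing between $\mathrm{Q}_1$ and $\mathrm{Q}_2$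 in time $\Delta t$. $T_A\overline{\log}$ is the tangent (derivative) of $\overline{\log}$ at $A$, a linear operator on matrices, and $(T_A\overline{\log})^\dagger$ is its adjoint. In the $\mathrm{P}$-equation the operator $(T_{\overline{\exp}(\Delta t\mathrm{X}^{n-1})}\overline{\log})^\dagger$ acts on $(\mathrm{Q}^{n-1})^\dagger\mathrm{P}^{n-1}$, and $((T_{\overline{\exp}(\Delta t\mathrm{X}^n)}\overline{\log})^\dagger)^{-1}$ acts on the whole product to its right.
   Formalization: The last factor of the P-equation is corrected from exp-bar(Δt X^n)^{-1} to (exp-bar(Δt X^n)^†)^{-1}, as the printed formula is false (e.g. SO(2)); pairings are taken with their real part, and P^n is the multiplier with (Q^n)^†P^n in V, as the first equation requires. *)

(* Defs.v *)
From HB Require Import structures.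
From mathcomp Require Import all_boot all_order all_algebra.
From mathcomp Require Import all_classical all_reals all_analysis.
From mathcomp Require Import spectral complex.
Set Implicit Arguments.
Unset Strict Implicit.
Unset Printing Implicit Defensive.
Import Order.TTheory GRing.Theory Num.Theory.
Import numFieldNormedType.Exports.
Local Open Scope sesquilinear_scope.
Local Open Scope ring_scope.

Section MatrixGeometry.
Context {R : realType} {d : nat}.
Local Notation M := 'M[R[i]]_d.
Implicit Types (U W Z A : M) (V G Om : set M) (f T : M -> M) (c : R -> M).

(* In this file [U^t*] is the transpose-conjugate. *)
Definition mxinner U W : R[i] := \tr (U *m W^t*).

(* Stationarity and duality are over the reals (V is a real vector space and
   l is real-valued), so pairings enter through the real part of [mxinner].
   The two agree when the matrices are real. *)
Definition pairing U W : R := complex.Re (mxinner U W).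

Definition mxnorm2 U : R := Num.sqrt (pairing U U).

Definition rscale (a : R) U : M := real_complex R a *: U.

Definition real_subspace V : Prop :=
  V 0 /\ forall (a : R) U W, V U -> V W -> V (rscale a U + W).

Definition real_linear T : Prop :=
  forall (a : R) U W, T (rscale a U + W) = rscale a (T U) + T W.

(* c is differentiable at t with derivative Z. *)
Definition mx_is_derive c (t : R) Z : Prop :=
  forall i j,
    is_derive t (1 : R) (fun s : R => complex.Re (c s i j)) (complex.Re (Z i j))
    /\ is_derive t (1 : R) (fun s : R => complex.Im (c s i j))
         (complex.Im (Z i j)).

(* Closed subgroup of GL_d(C). *)
Definition matrix_group G : Prop :=
  [/\ G 1%:M,
      forall A, G A -> A \in unitmx /\ G (invmx A),
      forall A B, G A -> G B -> G (A *m B) &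
      forall A, A \in unitmx ->
        (forall e : R, 0 < e -> exists2 B, G B & mxnorm2 (B - A) < e) -> G A].

(* Y t = exp (t W): d/dt Y = Y W, Y 0 = I. *)
Definition exp_curve W c : Prop :=
  c 0 = 1%:M /\ forall t : R, mx_is_derive c t (c t *m W).

Definition lie_algebra G V : Prop :=
  real_subspace V /\
  forall W, V W <-> exists2 c, exp_curve W c & forall t : R, G (c t).

(* T_A G; since L_W A = A W, it is the image of the Lie algebra V. *)
Definition tangent_space V A : set M := fun Z => exists2 W, V W & Z = A *m W.

Definition rel_open G Om : Prop :=
  (forall A, Om A -> G A) /\
  forall A, Om A -> exists2 e : R, 0 < e &
    forall B, G B -> mxnorm2 (B - A) < e -> Om B.

(* The identity log (exp W) = W can only hold for W near 0 in V when exp is not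
   injective. *)
Definition is_log V f : Prop :=
  exists2 r : R, 0 < r & forall W c,
    V W -> mxnorm2 W < r -> exp_curve W c -> f (c 1) = W.

(* lbar A = log A + O((A - I)^p) on Om. *)
Definition log_approx Om f (lbar : M -> M) (p : nat) : Prop :=
  exists C r : R, 0 < r /\ forall A, Om A -> mxnorm2 (A - 1%:M) < r ->
    mxnorm2 (lbar A - f A) <= C * mxnorm2 (A - 1%:M) ^+ p.

Definition approx_log G V Om (lbar : M -> M) (p : nat) : Prop :=
  [/\ rel_open G Om, Om 1%:M, forall A, Om A -> V (lbar A) &
      exists2 f, is_log V f & log_approx Om f lbar p].

(* A linear operator on a subspace S is represented by the operator on all
   matrices that extends it by zero on the orthogonal complement of S, so that
   a matrix U is fed to it as the covector [pairing U] on S.  No extension is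
   involved when S is the space of all matrices. *)
Definition vanishes_off (S : set M) T : Prop :=
  forall U, (forall W, S W -> pairing U W = 0) -> T U = 0.

(* T is the tangent at A of f : Om -> V, Om open in the group. *)
Definition is_tangent V Om f A T : Prop :=
  [/\ real_linear T, vanishes_off (tangent_space V A) T &
      forall c Z, c 0 = A -> (\forall t \near (0 : R), Om (c t)) ->
        mx_is_derive c 0 Z -> mx_is_derive (fun t => f (c t)) 0 (T Z)].

Definition is_adjoint T (Tadj : M -> M) : Prop :=
  forall U Z, pairing U (T Z) = pairing (Tadj U) Z.

(* Tinv is the inverse of T : S -> S'. *)
Definition is_inverse (S S' : set M) T (Tinv : M -> M) : Prop :=
  [/\ real_linear Tinv, vanishes_off S' Tinv,
      forall U, S U -> S' (T U) /\ Tinv (T U) = U &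
      forall U, S' U -> S (Tinv U) /\ T (Tinv U) = U].

(* g = dl/dX at X: delta l = <g, delta X>, with g in V. *)
Definition is_variational_derivative V (l : M -> R) X g : Prop :=
  V g /\ forall c W, c 0 = X -> (\forall t \near (0 : R), V (c t)) ->
    mx_is_derive c 0 W ->
    is_derive (0 : R) (1 : R) (fun t : R => l (c t)) (pairing g W).

(* Only X n, P n for n < N and Q n for n <= N are meaningful. *)
Definition action (N : nat) (dt : R) (l : M -> R) (lbar : M -> M)
    (X P Q : nat -> M) : R :=
  \sum_(1 <= n < N.+1)
    (l (X n.-1) +
     pairing (P n.-1)
       (rscale dt^-1 (Q n.-1 *m lbar (invmx (Q n.-1) *m Q n))
        - Q n.-1 *m X n.-1)).

(* A covector on T_Q G = Q V has a unique representative P for [pairing] with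
   Q^t* P in V; this is the meaning of P n being in the cotangent space at
   Q n, and is no restriction when V is the space of all matrices. *)
Definition configuration (N : nat) V G Om (X P Q : nat -> M) : Prop :=
  [/\ forall n, (n < N)%N -> V (X n),
      forall n, (n < N)%N -> V ((Q n)^t* *m P n),
      forall n, (n <= N)%N -> G (Q n) &
      forall n, (1 <= n <= N)%N -> Om (invmx (Q n.-1) *m Q n)].

(* delta (action) = 0 for variations with fixed end points Q 0 and Q N. *)
Definition stationary (N : nat) V G Om (dt : R) (l : M -> R) (lbar : M -> M)
    (X P Q : nat -> M) : Prop :=
  forall (Xc Pc Qc : R -> nat -> M) (dX dP dQ : nat -> M),
    Xc 0 = X -> Pc 0 = P -> Qc 0 = Q ->
    (\forall t \near (0 : R),
       [/\ configuration N V G Om (Xc t) (Pc t) (Qc t),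
           Qc t 0%N = Q 0%N & Qc t N = Q N]) ->
    (forall n, (n < N)%N -> mx_is_derive (fun t => Xc t n) 0 (dX n)) ->
    (forall n, (n < N)%N -> mx_is_derive (fun t => Pc t n) 0 (dP n)) ->
    (forall n, (n <= N)%N -> mx_is_derive (fun t => Qc t n) 0 (dQ n)) ->
    is_derive (0 : R) (1 : R)
      (fun t : R => action N dt l lbar (Xc t) (Pc t) (Qc t)) 0.

End MatrixGeometry.

(* Main.v *)
Require Import Defs.
From HB Require Import structures.
From mathcomp Require Import all_boot all_order all_algebra.
From mathcomp Require Import all_classical all_reals all_analysis.
From mathcomp Require Import perm spectral complex.
Set Implicit Arguments.
Unset Strict Implicit.
Unset Printing Implicit Defensive.
Import Order.TTheory GRing.Theory Num.Theory.
Import numFieldNormedType.Exports.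
Local Open Scope sesquilinear_scope.
Local Open Scope ring_scope.

(** Variations of P by [invmx (Q n)^t* W] and of X by [W], with [W] in V, give
    [lbar (Q n^-1 Q n.+1) = dt X n] and [dl (X n) = (Q n)^t* P n] by
    nondegeneracy of the pairing on V. A variation [Q n * exp (t W)] keeping
    [(Q n)^t* P n] fixed gives, with [A = Q n.-1^-1 Q n], [B = Q n^-1 Q n.+1]
    and [m k = (Q k)^t* P k],
      [<m n.-1, T_A (A W)> = <m n, T_B (W B)>],
    so [A^t* Tadj_A (m n.-1)] and [Tadj_B (m n) B^t*] agree as covectors on V.
    Replacing [W] by [B W B^-1], which is in V again, turns this into the
    equality of [A^t* Tadj_A (m n.-1) invmx B^t*] and [Tadj_B (m n)] on [B V], the
    only thing that the inverse of [Tadj_B] sees. *)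

(** * Calculus of complex-valued curves of a real parameter *)

Section ComplexCurves.
Context {R : realType}.
Implicit Types (f g : R -> R[i]) (t : R) (x y : R[i]).

(** One entry of [mx_is_derive], stated so that the two are convertible and matrix rules reduce to
    scalar ones. *)
Definition cx_is_derive f t x : Prop :=
  is_derive t (1 : R) (fun s : R => complex.Re (f s)) (complex.Re x) /\
  is_derive t (1 : R) (fun s : R => complex.Im (f s)) (complex.Im x).

Lemma cxReM x y :
  complex.Re (x * y) = complex.Re x * complex.Re y - complex.Im x * complex.Im y.
Proof. by case: x y => [a b] [c e]. Qed.

Lemma cxImM x y :
  complex.Im (x * y) = complex.Re x * complex.Im y + complex.Im x * complex.Re y.
Proof. by case: x y => [a b] [c e]. Qed.

Lemma cxReD x y : complex.Re (x + y) = complex.Re x + complex.Re y.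
Proof. by case: x y => [a b] [c e]. Qed.

Lemma cxImD x y : complex.Im (x + y) = complex.Im x + complex.Im y.
Proof. by case: x y => [a b] [c e]. Qed.

Lemma cxRe_conj x : complex.Re (x^* ) = complex.Re x.
Proof. by case: x. Qed.

Lemma cxIm_conj x : complex.Im (x^* ) = - complex.Im x.
Proof. by case: x. Qed.

Lemma cx_is_derive_cst t x : cx_is_derive (fun=> x) t 0.
Proof. by split; apply: is_derive_cst. Qed.

Lemma cx_is_deriveD f g t x y : cx_is_derive f t x -> cx_is_derive g t y ->
  cx_is_derive (fun s => f s + g s) t (x + y).
Proof.
move=> [rf jf] [rg jg]; split.
- rewrite cxReD (_ : (fun _ => _) =
    (fun s => complex.Re (f s)) + (fun s => complex.Re (g s))).
    exact: is_deriveD.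
  by apply/funext => s; rewrite cxReD.
- rewrite cxImD (_ : (fun _ => _) =
    (fun s => complex.Im (f s)) + (fun s => complex.Im (g s))).
    exact: is_deriveD.
  by apply/funext => s; rewrite cxImD.
Qed.

Lemma is_derive_mulr (u v : R -> R) t (a b : R) :
  is_derive t (1 : R) u a -> is_derive t (1 : R) v b ->
  is_derive t (1 : R) (fun s => u s * v s) (a * v t + u t * b).
Proof.
move=> du dv; apply: is_derive_eq (is_deriveM du dv) _.
by rewrite addrC mulrC.
Qed.

Lemma cx_is_deriveM f g t x y : cx_is_derive f t x -> cx_is_derive g t y ->
  cx_is_derive (fun s => f s * g s) t (x * g t + f t * y).
Proof.
move=> [rf jf] [rg jg]; split.
- rewrite (_ : (fun _ => _) =
    (fun s => complex.Re (f s) * complex.Re (g s)) -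
    (fun s => complex.Im (f s) * complex.Im (g s))); last first.
    by apply/funext => s; rewrite cxReM.
  apply: is_derive_eq
    (is_deriveB (is_derive_mulr rf rg) (is_derive_mulr jf jg)) _.
  by rewrite cxReD !cxReM opprD addrACA.
- rewrite (_ : (fun _ => _) =
    (fun s => complex.Re (f s) * complex.Im (g s)) +
    (fun s => complex.Im (f s) * complex.Re (g s))); last first.
    by apply/funext => s; rewrite cxImM.
  apply: is_derive_eq
    (is_deriveD (is_derive_mulr rf jg) (is_derive_mulr jf rg)) _.
  by rewrite cxImD !cxImM addrACA.
Qed.

(** Conjugation is real-linear, and the parameter is real, so holomorphy is not at stake. *)
Lemma cx_is_derive_conj f t x :
  cx_is_derive f t x -> cx_is_derive (fun s => (f s)^* ) t x^*.
Proof.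
move=> [rf jf]; split.
- rewrite cxRe_conj (_ : (fun _ => _) = (fun s => complex.Re (f s)))//.
  by apply/funext => s; rewrite cxRe_conj.
- rewrite cxIm_conj (_ : (fun _ => _) = - (fun s => complex.Im (f s))).
    exact: is_deriveN.
  by apply/funext => s; rewrite cxIm_conj.
Qed.

Lemma cx_is_derive_sum (I : Type) (r : seq I) (F : I -> R -> R[i])
    (x : I -> R[i]) t :
  (forall i, cx_is_derive (F i) t (x i)) ->
  cx_is_derive (fun s => \sum_(i <- r) F i s) t (\sum_(i <- r) x i).
Proof.
move=> dF; elim: r => [|i r IHr].
  rewrite big_nil (_ : (fun _ => _) = fun=> 0); first exact: cx_is_derive_cst.
  by apply/funext => s; rewrite big_nil.
rewrite big_cons (_ : (fun _ => _) =
  (fun s => F i s + \sum_(j <- r) F j s)); first exact: cx_is_deriveD.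
by apply/funext => s; rewrite big_cons.
Qed.

(** Existence suffices: this feeds the determinant, whose derivative is never evaluated. *)
Lemma cx_derivable_prod (I : Type) (r : seq I) (F : I -> R -> R[i]) t :
  (forall i, exists x, cx_is_derive (F i) t x) ->
  exists x, cx_is_derive (fun s => \prod_(i <- r) F i s) t x.
Proof.
move=> dF; elim: r => [|i r [y dr]].
  exists 0; rewrite (_ : (fun _ => _) = fun=> 1); first exact: cx_is_derive_cst.
  by apply/funext => s; rewrite big_nil.
have [x di] := dF i; exists (x * \prod_(j <- r) F j t + F i t * y).
rewrite (_ : (fun _ => _) = (fun s => F i s * \prod_(j <- r) F j s)).
  exact: cx_is_deriveM.
by apply/funext => s; rewrite big_cons.
Qed.

(** The inverse is the conjugate over the squared modulus [n2], which reduces the claim to a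
    nonvanishing real function. *)
Lemma cx_derivableV f t x : f t != 0 -> cx_is_derive f t x ->
  exists y, cx_is_derive (fun s => (f s)^-1) t y.
Proof.
move=> ft0 [rf jf].
pose n2 s := complex.Re (f s) * complex.Re (f s) +
             complex.Im (f s) * complex.Im (f s).
have n20 : n2 t != 0.
  apply: contra ft0; rewrite /n2 -!expr2 paddr_eq0 ?sqr_ge0// !sqrf_eq0.
  by rewrite eq_complex.
have dn2 : derivable n2 t (1 : R).
  have := is_deriveD (is_derive_mulr rf rf) (is_derive_mulr jf jf).
  by case.
have dV : derivable (fun s => (n2 s)^-1) t (1 : R) by exact: derivableV.
have dVP := derivableP dV.
have E s : (f s)^-1 = Complex (complex.Re (f s) * (n2 s)^-1)
                              (- (complex.Im (f s) * (n2 s)^-1)).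
  by rewrite /n2 -!expr2; case: (f s).
have dre := is_derive_mulr rf dVP.
have dim := is_deriveN (is_derive_mulr jf dVP).
(* The value of the derivative is read off from [dre] and [dim] by unification. *)
eexists (Complex _ _).
split.
- rewrite (_ : (fun _ => _) = (fun s => complex.Re (f s) * (n2 s)^-1))//.
  by apply/funext => s; rewrite E.
- rewrite (_ : (fun _ => _) = - (fun s => complex.Im (f s) * (n2 s)^-1))//.
  by apply/funext => s; rewrite E.
Qed.

End ComplexCurves.

(** * Algebra of the conjugate transpose and of inverses *)

Section ConjugateTranspose.
Context {C : numClosedFieldType} {d : nat}.
Implicit Types A B : 'M[C]_d.

Lemma trmxC_mul A B : (A *m B)^t* = B^t* *m A^t*.
Proof. by rewrite trmx_mul map_mxM. Qed.

Lemma trmxC_unitmx A : (A^t* \in unitmx) = (A \in unitmx).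
Proof. by rewrite map_unitmx unitmx_tr. Qed.

Lemma invmx_mul A B : A \in unitmx -> B \in unitmx ->
  invmx (A *m B) = invmx B *m invmx A.
Proof.
move=> uA uB; have uAB : A *m B \in unitmx by rewrite unitmx_mul uA.
apply: (can_inj (mulKmx uAB)).
by rewrite mulmxV// mulmxA mulmxK// mulmxV.
Qed.

End ConjugateTranspose.

(** * The pairing as a real Euclidean inner product *)

Section RealPairing.
Context {R : realType} {d : nat}.
Local Notation M := 'M[R[i]]_d.
Implicit Types (U W Y Z A : M) (a : R).

(** In real coordinates the pairing is the standard dot product; symmetry and definiteness follow
    from this form. *)
Lemma pairingE U W : pairing U W =
  \sum_i \sum_j (complex.Re (U i j) * complex.Re (W i j)
                 + complex.Im (U i j) * complex.Im (W i j)).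
Proof.
have ReS (I : finType) (F : I -> R[i]) :
    complex.Re (\sum_i F i) = \sum_i complex.Re (F i).
  by elim/big_rec2: _ => // i x y _ <-; rewrite cxReD.
rewrite /pairing /mxinner /mxtrace ReS; apply: eq_bigr => i _.
rewrite mxE ReS; apply: eq_bigr => j _.
by rewrite !mxE cxReM cxRe_conj cxIm_conj mulrN opprK.
Qed.

Lemma pairingC U W : pairing U W = pairing W U.
Proof.
rewrite !pairingE; apply: eq_bigr => i _; apply: eq_bigr => j _.
by congr (_ + _); rewrite mulrC.
Qed.

Lemma pairingDl U W Z : pairing (U + W) Z = pairing U Z + pairing W Z.
Proof. by rewrite /pairing /mxinner mulmxDl mxtraceD cxReD. Qed.

Lemma pairingZl a U W : pairing (rscale a U) W = a * pairing U W.
Proof.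
rewrite /pairing /mxinner /rscale -scalemxAl mxtraceZ cxReM/=.
by rewrite mul0r subr0.
Qed.

Lemma pairingZr a U W : pairing U (rscale a W) = a * pairing U W.
Proof. by rewrite pairingC pairingZl pairingC. Qed.

Lemma rscaleN1 U : rscale (-1) U = - U.
Proof. by rewrite /rscale rmorphN1 scaleN1r. Qed.

Lemma rscale1 U : rscale 1 U = U.
Proof. by rewrite /rscale rmorph1 scale1r. Qed.

Lemma rscaleA a b U : rscale a (rscale b U) = rscale (a * b) U.
Proof. by rewrite /rscale rmorphM scalerA. Qed.

Lemma rscale0 U : rscale 0 U = 0.
Proof. by rewrite /rscale rmorph0 scale0r. Qed.

Lemma rscaleAr a U W : U *m rscale a W = rscale a (U *m W).
Proof. by rewrite /rscale scalemxAr. Qed.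

Lemma pairingNl U W : pairing (- U) W = - pairing U W.
Proof. by rewrite -rscaleN1 pairingZl mulN1r. Qed.

Lemma pairingNr U W : pairing U (- W) = - pairing U W.
Proof. by rewrite pairingC pairingNl pairingC. Qed.

Lemma pairing0l W : pairing 0 W = 0.
Proof. by rewrite -(rscale0 0) pairingZl mul0r. Qed.

Lemma pairing0r W : pairing W 0 = 0.
Proof. by rewrite pairingC pairing0l. Qed.

(** Cyclicity of the trace. This moves [Q n] off the velocity and onto [P n]. *)
Lemma pairing_mull U W A : pairing U (A *m W) = pairing (A^t* *m U) W.
Proof.
by rewrite /pairing /mxinner trmxC_mul mulmxA mxtrace_mulC mulmxA.
Qed.

Lemma pairing_mulr U W A : pairing U (W *m A) = pairing (U *m A^t*) W.
Proof. by rewrite /pairing /mxinner trmxC_mul mulmxA. Qed.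

(** Definiteness replaces a density argument later on: a residual lying in V is tested against
    itself. *)
Lemma pairing_eq0 U : pairing U U = 0 -> U = 0.
Proof.
rewrite pairingE => /eqP.
have ge0 i j : 0 <= complex.Re (U i j) * complex.Re (U i j) +
                    complex.Im (U i j) * complex.Im (U i j).
  by rewrite -!expr2 addr_ge0// sqr_ge0.
rewrite psumr_eq0 => [/allP Z|i _]; last exact: sumr_ge0.
apply/matrixP => i j; have := Z i (mem_index_enum i).
rewrite psumr_eq0// => /allP /(_ j (mem_index_enum j)).
rewrite -!expr2 paddr_eq0 ?sqr_ge0// !sqrf_eq0 => Uij.
by apply/eqP; rewrite mxE eq_complex.
Qed.

End RealPairing.

(** * Differentiation of matrix curves *)

Section MatrixCurves.
Context {R : realType} {d : nat}.
Local Notation M := 'M[R[i]]_d.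
Implicit Types (U W Y Z A : M) (c e : R -> M) (t : R).

Lemma mx_is_derive_cst t A : mx_is_derive (fun=> A) t 0.
Proof. by move=> i j; rewrite mxE; exact: cx_is_derive_cst. Qed.

Lemma mx_is_deriveD c e t Y Z : mx_is_derive c t Y -> mx_is_derive e t Z ->
  mx_is_derive (fun s => c s + e s) t (Y + Z).
Proof.
move=> dc de i j; rewrite mxE.
rewrite -/(cx_is_derive (fun s => (c s + e s) i j) t _).
rewrite (_ : (fun _ => _) = fun s => c s i j + e s i j).
  exact: cx_is_deriveD (dc i j) (de i j).
by apply/funext => s; rewrite mxE.
Qed.

Lemma mx_is_deriveM c e t Y Z : mx_is_derive c t Y -> mx_is_derive e t Z ->
  mx_is_derive (fun s => c s *m e s) t (Y *m e t + c t *m Z).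
Proof.
move=> dc de i j.
rewrite -/(cx_is_derive (fun s => (c s *m e s) i j) t _).
rewrite !mxE -big_split (_ : (fun _ => _) = fun s => \sum_k c s i k * e s k j).
  by apply: cx_is_derive_sum => k; exact: cx_is_deriveM (dc i k) (de k j).
by apply/funext => s; rewrite mxE.
Qed.

Lemma mx_is_derive_mull A c t Z :
  mx_is_derive c t Z -> mx_is_derive (fun s => A *m c s) t (A *m Z).
Proof.
by move=> /(mx_is_deriveM (mx_is_derive_cst t A)); rewrite mul0mx add0r.
Qed.

Lemma mx_is_derive_mulr A c t Z :
  mx_is_derive c t Z -> mx_is_derive (fun s => c s *m A) t (Z *m A).
Proof.
by move=> /mx_is_deriveM /(_ (mx_is_derive_cst t A)); rewrite mulmx0 addr0.
Qed.

Lemma mx_is_derive_trmxC c t Z :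
  mx_is_derive c t Z -> mx_is_derive (fun s => (c s)^t*) t (Z^t*).
Proof.
move=> dc i j; have := cx_is_derive_conj (dc j i); rewrite !mxE.
rewrite -/(cx_is_derive (fun s => ((c s)^t*) i j) t _).
by rewrite (_ : (fun s => ((c s)^t*) i j) = fun s => (c s j i)^*)//;
  apply/funext => s; rewrite !mxE.
Qed.

Lemma mx_is_derive_line t U W : mx_is_derive (fun s => U + rscale s W) t W.
Proof.
rewrite -[X in mx_is_derive _ _ X]add0r.
apply: mx_is_deriveD; first exact: mx_is_derive_cst.
move=> i j.
rewrite -/(cx_is_derive (fun s => (rscale s W) i j) t _).
rewrite (_ : (fun _ => _) = fun s => real_complex R s * W i j); last first.
  by apply/funext => s; rewrite mxE.
have dr : cx_is_derive (real_complex R) t 1.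
  by split; [exact: is_derive_id|exact: is_derive_cst].
by have := cx_is_deriveM dr (cx_is_derive_cst t (W i j)); rewrite mulr0 addr0 mul1r.
Qed.

Lemma is_derive_pairing c e t Y Z : mx_is_derive c t Y -> mx_is_derive e t Z ->
  is_derive t (1 : R) (fun s => pairing (c s) (e s))
    (pairing Y (e t) + pairing (c t) Z).
Proof.
move=> dc de; have dm := mx_is_deriveM dc (mx_is_derive_trmxC de).
rewrite -cxReD -mxtraceD.
exact: (cx_is_derive_sum _ (fun i => dm i i)).1.
Qed.

(** The squared distance to [c t] is a differentiable, hence continuous, real function vanishing at
    [t]. *)
Lemma mx_is_derive_near c t Z (r : R) : 0 < r -> mx_is_derive c t Z ->
  \forall s \near t, mxnorm2 (c s - c t) < r.
Proof.
move=> r0 dc.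
have db : mx_is_derive (fun s => c s - c t) t (Z + 0).
  by apply: mx_is_deriveD => //; exact: mx_is_derive_cst.
have [df _] := is_derive_pairing db db.
have cf := differentiable_continuous ((derivable1_diffP _ _).1 df).
have r20 : pairing (c t - c t) (c t - c t) < r ^+ 2.
  by rewrite subrr pairing0l exprn_gt0.
have near_r2 : \forall s \near t, pairing (c s - c t) (c s - c t) < r ^+ 2.
  exact: cvgr_lt cf _ r20.
apply: filterS near_r2 => s lts.
by rewrite /mxnorm2 -[r]ger0_norm ?ltW// -sqrtr_sqr ltr_sqrt// exprn_gt0.
Qed.

(** By the Leibniz expansion over permutations. *)
Lemma mx_derivable_det n (c : R -> 'M[R[i]]_n) t :
  (forall i j, exists x, cx_is_derive (fun s => c s i j) t x) ->
  exists x, cx_is_derive (fun s => \det (c s)) t x.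
Proof.
move=> dc.
have /choice [x dx] (s : 'S_n) : exists x,
    cx_is_derive (fun u => (-1) ^+ s * \prod_i c u i (s i)) t x.
  have [y dy] := cx_derivable_prod (index_enum _) (fun i => dc i (s i)).
  by eexists; apply: cx_is_deriveM dy; exact: cx_is_derive_cst.
by exists (\sum_s x s); exact: cx_is_derive_sum.
Qed.

(* Cramer's rule gives differentiability; the value then follows from
   [c s *m invmx (c s) = 1]. *)
Lemma mx_is_derive_inv c t Z : (forall s, c s \in unitmx) ->
  mx_is_derive c t Z ->
  mx_is_derive (fun s => invmx (c s)) t (- (invmx (c t) *m Z *m invmx (c t))).
Proof.
move=> uc dc.
have dcE i j : exists x, cx_is_derive (fun s => c s i j) t x.
  by exists (Z i j); exact: dc.
have [x dx] := mx_derivable_det dcE.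
have det0 : \det (c t) != 0 by rewrite -unitfE; exact: uc.
have [y dy] := cx_derivableV det0 dx.
have /choice [D' dD'] (ij : 'I_d * 'I_d) : exists z,
    cx_is_derive (fun s => invmx (c s) ij.1 ij.2) t z.
  case: ij => i j /=.
  (* Entry [(i, j)] of the inverse is the cofactor at [(j, i)] over the determinant, hence the
     swapped indices. *)
  have [z dz] : exists z, cx_is_derive
      (fun s => \det (row' j (col' i (c s)))) t z.
    apply: mx_derivable_det => k l.
    exists (Z (lift j k) (lift i l)).
    rewrite (_ : (fun _ => _) = fun s => c s (lift j k) (lift i l)); first exact: dc.
    by apply/funext => s; rewrite !mxE.
  have := cx_is_deriveM dy (cx_is_deriveM (cx_is_derive_cst t ((-1) ^+ (j + i))) dz).
  rewrite (_ : (fun _ => _) = fun s => invmx (c s) i j); first by eexists; eauto.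
  by apply/funext => s; rewrite /invmx uc !mxE.
pose D : M := \matrix_(i, j) D' (i, j).
have dD : mx_is_derive (fun s => invmx (c s)) t D.
  by move=> i j; rewrite mxE; exact: dD' (i, j).
suff DE : D = - (invmx (c t) *m Z *m invmx (c t)) by rewrite -DE.
have d1 := mx_is_deriveM dc dD.
have d0 : mx_is_derive (fun s => c s *m invmx (c s)) t 0.
  rewrite (_ : (fun _ => _) = fun=> 1%:M); first exact: mx_is_derive_cst.
  by apply/funext => s; rewrite mulmxV.
have E : Z *m invmx (c t) + c t *m D = 0.
  apply/matrixP => i j; apply/eqP; rewrite eq_complex; apply/andP.
  (* [d1] and [d0] equate their values with the derivative of one and the same function;
     substituting both makes the sides identical. *)
  have [[_ <-] [_ <-]] := d1 i j; have [[_ <-] [_ <-]] := d0 i j.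
  by [].
have /(congr1 (mulmx (invmx (c t)))) := E.
by rewrite mulmxDr mulmx0 mulKmx// mulmxA addrC => /eqP; rewrite addr_eq0 => /eqP.
Qed.

End MatrixCurves.

(** * Closure properties of the group and its Lie algebra *)

Section LieAlgebra.
Context {R : realType} {d : nat}.
Local Notation M := 'M[R[i]]_d.
Variables G V : set M.
Hypotheses (hG : matrix_group G) (hV : lie_algebra G V).

Lemma group_unitmx A : G A -> A \in unitmx.
Proof. by case: hG => _ GV _ _ /GV[]. Qed.

Lemma groupV A : G A -> G (invmx A).
Proof. by case: hG => _ GV _ _ /GV[]. Qed.

Lemma groupM A B : G A -> G B -> G (A *m B).
Proof. by case: hG => _ _ GM _; exact: GM. Qed.

Lemma lie_algebraB U W : V U -> V W -> V (U - W).
Proof.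
case: hV => -[_ VD] _ VU VW.
by rewrite addrC -rscaleN1; exact: VD.
Qed.

Lemma lie_algebraZ a W : V W -> V (rscale a W).
Proof.
by case: hV => -[V0 VD] _ VW; rewrite -[rscale a W]addr0; exact: VD.
Qed.

(** Conjugating the exponential curve of [W] by [B] stays in G and yields the exponential curve of
    the conjugate of [W]. *)
Lemma lie_algebra_adjoint B W : G B -> V W -> V (B *m W *m invmx B).
Proof.
move=> GB VW; have uB := group_unitmx GB.
have [c [c0 dc] Gc] := (hV.2 W).1 VW.
apply/hV.2; exists (fun t => B *m c t *m invmx B) => [|t].
  split=> [|t]; first by rewrite c0 mulmx1 mulmxV.
  have := mx_is_derive_mulr (invmx B) (mx_is_derive_mull B (dc t)).
  by rewrite !mulmxA mulmxKV.
by apply: groupM; [exact: groupM|exact: groupV].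
Qed.

End LieAlgebra.

(** * First variation of the action and the resulting Euler-Lagrange equations *)

Section FirstVariation.
Context {R : realType} {d : nat}.
Local Notation M := 'M[R[i]]_d.
Variables (N : nat) (dt : R) (G V Om : set M) (l : M -> R).
Variables (dl lbar : M -> M) (T : M -> M -> M) (X P Q : nat -> M).
Hypotheses (hG : matrix_group G) (hV : lie_algebra G V).
Hypothesis hl : forall Y, V Y -> is_variational_derivative V l Y (dl Y).
Hypothesis hOm : rel_open G Om.
Hypothesis Vlbar : forall A, Om A -> V (lbar A).
Hypothesis hT : forall A, Om A -> is_tangent V Om lbar A (T A).
Hypothesis hconf : configuration N V G Om X P Q.
Hypothesis hstat : stationary N V G Om dt l lbar X P Q.

Let inc n := invmx (Q n.-1) *m Q n.
(** [P n] pulled back to the identity by left translation: the body momentum, a covector on V. *)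
Let mom n := (Q n)^t* *m P n.

(* The variation is parametrised by the left-trivialised quantities
   [invmx (Q n) *m Q' n] and [(Q n)^t* *m P n], which range over V. *)
Lemma first_variation (xi eta om : nat -> M) (c : nat -> R -> M) :
  (forall n, V (xi n)) -> (forall n, V (eta n)) ->
  (forall n t, G (c n t)) -> (forall n, c n 0 = 1%:M) ->
  (forall n, mx_is_derive (c n) 0 (om n)) ->
  (forall t, c 0%N t = 1%:M) -> (forall t, c N t = 1%:M) ->
  \sum_(n < N)
    (pairing (dl (X n)) (xi n) +
     (pairing (eta n) (rscale dt^-1 (lbar (inc n.+1)) - X n) +
      pairing (mom n)
        (rscale dt^-1 (T (inc n.+1) (inc n.+1 *m om n.+1 - om n *m inc n.+1))
         - xi n))) = 0.
Proof.
move=> Vxi Veta Gc c0 dc cs ce.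
have [VX VP GQ OQ] := hconf.
have uc n t : c n t \in unitmx by exact: group_unitmx (Gc n t).
have uQ n : (n <= N)%N -> Q n \in unitmx by move=> /GQ; exact: group_unitmx.
pose Xc t n := if (n < N)%N then X n + rscale t (xi n) else X n.
pose Qc t n := Q n *m c n t.
(* Chosen so that the body momentum is affine in [t] with direction [eta n], hence remains in V.
   From index [N] on [P n] is kept. *)
pose Pc t n := if (n < N)%N
  then (invmx (Qc t n))^t* *m (mom n + rscale t (eta n)) else P n.
have uQc n t : (n <= N)%N -> Qc t n \in unitmx.
  by move=> nN; rewrite unitmx_mul uQ// uc.
have momc n t : (n < N)%N -> (Qc t n)^t* *m Pc t n = mom n + rscale t (eta n).
  move=> nN; rewrite /Pc nN mulmxA -trmxC_mul mulVmx ?uQc 1?ltnW//.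
  by rewrite trmx1 map_mx1 mul1mx.
have dX n : (n < N)%N -> mx_is_derive (fun t => Xc t n) 0 (xi n).
  by move=> nN; rewrite /Xc nN; exact: mx_is_derive_line.
have dQ n : (n <= N)%N -> mx_is_derive (fun t => Qc t n) 0 (Q n *m om n).
  by move=> nN; exact: mx_is_derive_mull.
(* [stationary] asks only that this derivative exists; its value cancels once the action is written
   in body momenta. *)
have /choice [dP dPE] n : exists Z,
    (n < N)%N -> mx_is_derive (fun t => Pc t n) 0 Z.
  case: (ltnP n N) => nN; last by exists 0.
  eexists => _; rewrite /Pc nN; apply: mx_is_deriveM; last exact: mx_is_derive_line.
  apply: mx_is_derive_trmxC; apply: mx_is_derive_inv; last exact: dQ (ltnW nN).
  by move=> s; exact: uQc (ltnW nN).
pose incc n t := invmx (Qc t n.-1) *m Qc t n.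
have inccE n t : (1 <= n <= N)%N ->
    incc n t = invmx (c n.-1 t) *m inc n *m c n t.
  case: n => // n /andP[_ nN].
  by rewrite /incc /inc /Qc invmx_mul ?uQ ?uc ?(ltnW nN)// !mulmxA.
have Xc0 : Xc 0 = X.
  by apply/funext => n; rewrite /Xc rscale0 addr0 if_same.
have Qc0 : Qc 0 = Q by apply/funext => n; rewrite /Qc c0 mulmx1.
have Pc0 : Pc 0 = P.
  apply/funext => n; rewrite /Pc rscale0 addr0; case: ifP => // nN.
  rewrite Qc0 /mom mulmxA -trmxC_mul mulmxV ?uQ 1?ltnW//.
  by rewrite trmx1 map_mx1 mul1mx.
(* Product rule on [inccE] at 0, where both curves [c] are the identity. *)
have dinc n : (1 <= n <= N)%N ->
    mx_is_derive (incc n) 0 (inc n *m om n - om n.-1 *m inc n).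
  move=> nN; rewrite (_ : incc n = fun t => invmx (c n.-1 t) *m inc n *m c n t).
    have dci := mx_is_derive_inv (uc n.-1) (dc n.-1).
    have := mx_is_deriveM (mx_is_derive_mulr (inc n) dci) (dc n).
    by rewrite !c0 invmx1 !mulmx1 !mul1mx mulNmx addrC.
  by apply/funext => t; exact: inccE.
have Gincc n t : (1 <= n <= N)%N -> G (incc n t).
  move=> /andP[n0 nN]; apply: (groupM hG); first apply: (groupV hG);
    by apply: (groupM hG) => //; apply: GQ; rewrite // (leq_trans (leq_pred n)).
(* [Om] is open only relative to G, so both continuity and [Gincc] are used. *)
have nOm n : (1 <= n <= N)%N -> \forall t \near (0 : R), Om (incc n t).
  move=> nN; have Oinc : Om (incc n 0) by rewrite /incc Qc0; exact: OQ.
  have [r r0 Or] := hOm.2 _ Oinc.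
  apply: filterS (mx_is_derive_near r0 (dinc n nN)) => t.
  by apply: Or; exact: Gincc.
(* A neighbourhood common to all indices exists because there are finitely many of them. *)
have nOmN : \forall t \near (0 : R), forall n, (1 <= n <= N)%N -> Om (incc n t).
  have H : \forall t \near (0 : R), forall n : 'I_N, Om (incc n.+1 t).
    apply: (@filter_forall _ 'I_N (fun n t => Om (incc n.+1 t)) (nbhs (0 : R)) _) => n.
    by apply: nOm; rewrite /= ltn_ord.
  apply: filterS H => t H [//|n] nN; exact: (H (Ordinal nN)).
have VD := hV.1.2.
have Vline Y W t : V Y -> V W -> V (Y + rscale t W).
  by move=> VY VW; rewrite addrC; exact: VD.
have nconf : \forall t \near (0 : R),
    [/\ configuration N V G Om (Xc t) (Pc t) (Qc t),
        Qc t 0%N = Q 0%N & Qc t N = Q N].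
  apply: filterS nOmN => t Omt; split; rewrite /Qc ?cs ?ce ?mulmx1//.
  split=> [n nN|n nN|n nN|n nN]; last exact: Omt.
  - by rewrite /Xc nN; apply: Vline => //; exact: VX.
  - by rewrite momc//; apply: Vline => //; exact: VP.
  - by apply: (groupM hG) => //; exact: GQ.
have dact := hstat Xc0 Pc0 Qc0 nconf dX dPE dQ.
pose term n t := l (Xc t n.-1) +
  pairing (mom n.-1 + rscale t (eta n.-1))
          (rscale dt^-1 (lbar (incc n t)) - Xc t n.-1).
(* Moving [Qc] across the pairing leaves an action depending on P and Q only through body momenta
   and increments. *)
have actE t : action N dt l lbar (Xc t) (Pc t) (Qc t) =
    \sum_(1 <= n < N.+1) term n t.
  apply: eq_big_nat => -[//|n] /= nN; rewrite /term /=; congr (_ + _).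
  rewrite -momc// -pairing_mull mulmxBr.
  by rewrite rscaleAr.
have dterm n : (1 <= n <= N)%N -> is_derive (0 : R) (1 : R) (term n)
    (pairing (dl (X n.-1)) (xi n.-1) +
     (pairing (eta n.-1) (rscale dt^-1 (lbar (inc n)) - X n.-1) +
      pairing (mom n.-1)
        (rscale dt^-1 (T (inc n) (inc n *m om n - om n.-1 *m inc n))
         - xi n.-1))).
  move=> nN; have nN' : (n.-1 < N)%N by case: n nN.
  have i0 : incc n 0 = inc n by rewrite /incc Qc0.
  have [_ dlX] := hl (VX _ nN').
  have Xcn0 : (fun t => Xc t n.-1) 0 = X n.-1 by rewrite Xc0.
  have dl1 : is_derive (0 : R) (1 : R) (fun t => l (Xc t n.-1))
      (pairing (dl (X n.-1)) (xi n.-1)).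
    apply: dlX (Xcn0) _ (dX _ nN'); apply: filterE => t.
    by rewrite /Xc nN'; apply: Vline => //; exact: VX.
  have [_ _ dT] := hT (OQ _ nN).
  have dlb := dT _ _ i0 (nOm _ nN) (dinc _ nN).
  have dneg : mx_is_derive (fun t => - Xc t n.-1) 0 (- xi n.-1).
    have := mx_is_derive_mull (- 1%:M) (dX _ nN').
    rewrite mulNmx mul1mx.
    rewrite (_ : (fun t => - 1%:M *m Xc t n.-1) = fun t => - Xc t n.-1)//.
    by apply/funext => t; rewrite mulNmx mul1mx.
  have dsc : mx_is_derive (fun t => rscale dt^-1 (lbar (incc n t))) 0
      (rscale dt^-1 (T (inc n) (inc n *m om n - om n.-1 *m inc n))).
    (* Scaling is treated as multiplication by a scalar matrix, to reuse the product rule. *)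
    have := mx_is_derive_mull (rscale dt^-1 1%:M) dlb.
    rewrite /rscale -scalemxAl mul1mx.
    rewrite (_ : (fun t => _ *m lbar (incc n t)) =
      fun t => real_complex R dt^-1 *: lbar (incc n t))//.
    by apply/funext => t; rewrite -scalemxAl mul1mx.
  have dp := is_derive_pairing (mx_is_derive_line 0 (mom n.-1) (eta n.-1))
    (mx_is_deriveD dsc dneg).
  have := is_deriveD dl1 dp.
  by rewrite /= i0 Xc0 rscale0 addr0.
have dsum : is_derive (0 : R) (1 : R) (fun t => \sum_(1 <= n < N.+1) term n t) 0.
  by rewrite -(funext actE).
(* The derivative of the action is now known twice, as this sum and as 0 by stationarity; uniqueness
   concludes. *)
have := is_derive_sum (fun n : 'I_N => dterm n.+1 (ltn_ord n)).
rewrite (_ : \sum_(n < N) _ = fun t => \sum_(1 <= n < N.+1) term n t).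
  move=> [_ D1]; have [_ D0] := dsum.
  by rewrite -[LHS]D1 D0.
by apply/funext => t; rewrite fct_sumE big_add1 big_mkord.
Qed.

Lemma tangent0 n : (n < N)%N -> T (inc n.+1) 0 = 0.
Proof.
move=> nN; have [_ _ _ OQ] := hconf; have [Tlin _ _] := hT (OQ n.+1 nN).
by have := Tlin (-1) 0 0; rewrite !rscaleN1 addr0 oppr0 addNr.
Qed.

Lemma tangentN n Y : (n < N)%N -> T (inc n.+1) (- Y) = - T (inc n.+1) Y.
Proof.
move=> nN; have [_ _ _ OQ] := hconf; have [Tlin _ _] := hT (OQ n.+1 nN).
by have := Tlin (-1) Y 0; rewrite !rscaleN1 tangent0// !addr0.
Qed.

(** Test direction supported at one index, isolating the summands that involve it. *)
Let only (m : nat) (W : M) : nat -> M := fun n => if n == m then W else 0.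

Let V_only m W n : V W -> V (only m W n).
Proof. by rewrite /only; case: ifP => // _ _; exact: hV.1.1. Qed.

(** Freezing Q at the constant curve 1 reduces every tangent term to [T] at 0, which vanishes. *)
Lemma first_variation_XP (xi eta : nat -> M) :
  (forall n, V (xi n)) -> (forall n, V (eta n)) ->
  \sum_(n < N)
    (pairing (dl (X n)) (xi n) +
     (pairing (eta n) (rscale dt^-1 (lbar (inc n.+1)) - X n) -
      pairing (mom n) (xi n))) = 0.
Proof.
move=> Vxi Veta; have G1 : G 1%:M by case: hG.
rewrite -[RHS](@first_variation xi eta (fun=> 0) (fun _ _ => 1%:M))// => [|n].
  apply: eq_bigr => n _; rewrite mulmx0 mul0mx subr0 tangent0//.
  by rewrite /rscale scaler0 sub0r pairingNr.
exact: mx_is_derive_cst.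
Qed.

(** Varying [X n] along the residual, which is in V because [dl (X n)] and [mom n] are, makes its
    squared norm vanish. *)
Lemma momentum_eq n : (n < N)%N -> dl (X n) = (Q n)^t* *m P n.
Proof.
move=> nN; have [VX VP _ _] := hconf; have [Vdl _] := hl (VX n nN).
have VW : V (dl (X n) - mom n) by apply: (lie_algebraB hV) => //; exact: VP.
have := @first_variation_XP (only n (dl (X n) - mom n)) (fun=> 0)
  (fun k => V_only n k VW) (fun=> hV.1.1).
rewrite (bigD1 (Ordinal nN))//= big1 ?addr0 => [|k kn].
  rewrite /only eqxx pairing0l add0r -pairingNl -pairingDl => /pairing_eq0/eqP.
  by rewrite subr_eq0 => /eqP.
by rewrite /only ifN// !pairing0r pairing0l subrr addr0.
Qed.

(** Dual to the previous argument: the momentum is varied along the velocity residual. *)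
Lemma velocity_eq n : (n < N)%N -> rscale dt^-1 (lbar (inc n.+1)) = X n.
Proof.
move=> nN; have [VX _ _ OQ] := hconf.
have VW : V (rscale dt^-1 (lbar (inc n.+1)) - X n).
  by apply: (lie_algebraB hV); [apply: (lie_algebraZ hV); apply/Vlbar/OQ|exact: VX].
have := @first_variation_XP (fun=> 0) (only n _)
  (fun=> hV.1.1) (fun k => V_only n k VW).
rewrite (bigD1 (Ordinal nN))//= big1 ?addr0 => [|k kn].
  rewrite /only eqxx !pairing0r subr0 add0r => /pairing_eq0/eqP.
  by rewrite subr_eq0 => /eqP.
by rewrite /only ifN// !pairing0r pairing0l subrr addr0.
Qed.

(** Moving the interior node [Q n.+1] alone changes two increments: the right factor of [inc n.+1]
    and, with opposite sign, the left factor of [inc n.+2]. *)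
Lemma momentum_balance n W : dt != 0 -> (n.+1 < N)%N -> V W ->
  pairing (mom n) (T (inc n.+1) (inc n.+1 *m W)) =
  pairing (mom n.+1) (T (inc n.+2) (W *m inc n.+2)).
Proof.
move=> dt0 nN VW; have nN' := ltnW nN.
have [c [c0 dc] Gc] := (hV.2 W).1 VW; have G1 : G 1%:M by case: hG.
pose cc k : R -> M := if k == n.+1 then c else fun=> 1%:M.
have Gcc k t : G (cc k t) by rewrite /cc; case: ifP.
have cc0 k : cc k 0 = 1%:M by rewrite /cc; case: ifP.
have dcc k : mx_is_derive (cc k) 0 (only n.+1 W k).
  rewrite /cc /only; case: ifP => _; last exact: mx_is_derive_cst.
  by have := dc 0; rewrite c0 mul1mx.
have ccN t : cc N t = 1%:M by rewrite /cc gtn_eqF.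
(* Both end points stay fixed: [cc 0] is constant by computation, [cc N] because [n.+1 < N]. *)
have := first_variation (fun=> hV.1.1) (fun=> hV.1.1) Gcc cc0 dcc
  (fun=> erefl) ccN.
(* Only summands [n] and [n.+1] survive, since summand [k] involves nodes [k] and [k.+1]. *)
rewrite (bigD1 (Ordinal nN'))//= (bigD1 (Ordinal nN))/=; last first.
  by rewrite -val_eqE/= gtn_eqF.
rewrite big1 => [|k /andP[]]; last first.
  rewrite -!val_eqE /only eqSS /= => /negbTE -> /negbTE -> /=.
  rewrite mulmx0 mul0mx !subr0 tangent0// /rscale scaler0.
  by rewrite !pairing0r pairing0l !addr0.
rewrite /only !eqxx ltn_eqF// gtn_eqF// mulmx0 mul0mx subr0 sub0r tangentN//.
rewrite !pairing0r !pairing0l !add0r addr0 !subr0 -/(rscale _ _).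
rewrite !pairingZr pairingNr -mulrDr => /eqP.
by rewrite mulf_eq0 invr_eq0 (negbTE dt0)/= subr_eq0 => /eqP.
Qed.

End FirstVariation.

(** * The symplectic Euler scheme in terms of [ebar] *)

Theorem theorem28 (R : realType) (d N p : nat) (dt : R)
  (G V Om : set 'M[R[i]]_d)
  (l : 'M[R[i]]_d -> R) (dl : 'M[R[i]]_d -> 'M[R[i]]_d)
  (lbar ebar : 'M[R[i]]_d -> 'M[R[i]]_d)
  (T Tadj Tadj_inv : 'M[R[i]]_d -> 'M[R[i]]_d -> 'M[R[i]]_d)
  (X P Q : nat -> 'M[R[i]]_d)
  (hdt : 0 < dt) (hp : (0 < p)%N)
  (hG : matrix_group G) (hV : lie_algebra G V)
  (hl : forall Y, V Y -> is_variational_derivative V l Y (dl Y))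
  (hlbar : approx_log G V Om lbar p)
  (hebar : forall A, Om A -> ebar (lbar A) = A)
  (hT : forall A, Om A -> is_tangent V Om lbar A (T A))
  (hTadj : forall A, Om A -> is_adjoint (T A) (Tadj A))
  (hTinv : forall n, (1 <= n < N)%N ->
     let A := ebar (rscale dt (X n)) in
     is_inverse V (tangent_space V A) (Tadj A) (Tadj_inv A))
  (hconf : configuration N V G Om X P Q)
  (hstat : stationary N V G Om dt l lbar X P Q) :
  [/\ forall n, (1 <= n <= N)%N ->
        dl (X n.-1) = (Q n.-1)^t* *m P n.-1,
      forall n, (1 <= n <= N)%N ->
        Q n = Q n.-1 *m ebar (rscale dt (X n.-1)) &
      forall n, (1 <= n < N)%N ->
        let A := ebar (rscale dt (X n.-1)) in
        let B := ebar (rscale dt (X n)) in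
        P n = invmx ((Q n)^t*) *m
              Tadj_inv B (A^t* *m Tadj A ((Q n.-1)^t* *m P n.-1)
                          *m invmx (B^t*))].
Proof.
have [hOm _ Vlbar _] := hlbar; have [VX VP GQ OQ] := hconf.
have dt0 : dt != 0 by rewrite gt_eqF.
have uQ n : (n <= N)%N -> Q n \in unitmx by move=> /GQ; exact: group_unitmx hG _.
(* [velocity_eq] says that [lbar] of the increment is [dt X n]; applying [ebar] recovers the
   increment, which lies in [Om]. *)
have incE n : (n < N)%N -> ebar (rscale dt (X n)) = invmx (Q n) *m Q n.+1.
  move=> nN; rewrite -(velocity_eq hG hV hl hOm Vlbar hT hconf hstat nN).
  by rewrite rscaleA mulfV// rscale1 hebar//; exact: (OQ n.+1).
split=> [[//|n] nN|[//|n] nN|[//|n] nN A B].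
- exact: (momentum_eq hG hV hl hOm hT hconf hstat).
- by rewrite incE// mulKVmx// uQ// ltnW.
have [nN1 nN2] : (n < N)%N /\ (n.+1 < N)%N by split=> //; exact: ltnW.
have OA : Om A by rewrite /A incE//; exact: (OQ n.+1).
have OB : Om B by rewrite /B incE//; exact: (OQ n.+2).
have GB : G B := hOm.1 _ OB; have uB := group_unitmx hG GB.
have [Tinv_lin Tinv_off TinvK _] := hTinv n.+1 nN; rewrite -/B in Tinv_lin Tinv_off TinvK.
(* Arguments agreeing as covectors on [B V] differ by a matrix orthogonal to it, which [Tadj_inv B]
   kills. *)
have Tinv_eq U W : (forall Z, V Z -> pairing U (B *m Z) = pairing W (B *m Z)) ->
    Tadj_inv B U = Tadj_inv B W.
  move=> UW; have off : Tadj_inv B (U - W) = 0.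
    by apply: Tinv_off => _ [Z VZ ->]; rewrite pairingDl pairingNl UW// subrr.
  by have := Tinv_lin 1 (U - W) W; rewrite !rscale1 subrK off add0r.
(* Left inversion applies to the body momentum at [n.+1] because [configuration] places it in V. *)
have [_ momK] := TinvK _ (VP _ nN).
rewrite -[LHS](mulKmx (_ : (Q n.+1)^t* \in unitmx)); last first.
  by rewrite trmxC_unitmx uQ// ltnW.
congr (_ *m _); rewrite -[LHS]momK; apply: Tinv_eq => Z VZ.
(* With [W = B Z B^-1] the right-hand direction [W B] of the balance becomes [B Z], an arbitrary
   tangent vector at [B]. *)
have VW := lie_algebra_adjoint hG hV GB VZ.
have := momentum_balance hG hV hl hOm hT hconf hstat dt0 nN VW.
rewrite /= -!incE// -/A -/B hTadj// hTadj// mulmxKV// => bal.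
(* Writing [B Z] as [(B Z B^-1) B] lets the last [B] cross the pairing as [B^t*], cancelling
   [invmx B^t*]. *)
rewrite -bal -[in RHS](mulmxKV uB (B *m Z)) [RHS]pairing_mulr.
by rewrite mulmxKV ?trmxC_unitmx// -pairing_mull.
Qed.
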